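(* Let $p$ be a prime, let $q$ be a power of $p$, let $k\ge 0$ be an integer, and let $a$ be a positive integer divisible by $p^{k}$. Then \[ 1+(q-1)\sum_{\substack{b\in\mathbb{Z}\\ 0\le b(q-1)<a}} \binom{a}{ b(q-1)}\equiv 0\pmod{p^{k+1}}. \] *)

(* Defs.v *)
From mathcomp Require Import all_boot.

(* Main.v *)
(* Let N be the matrix of multiplication by Y on Z[Y]/(Y^q - Y) in the basis
   1, Y, ..., Y^(q-1). For m > 0 the trace of N^m is q - 1 if q - 1 divides m and
   0 otherwise, so that the left-hand side of the congruence is
   tr ((1 + N)^a) - tr (N^a). Since (1 + Y)^q = 1 + Y modulo p and Y^q - Y,
   the substitution of 1 + Y for Y, given by the unimodular Pascal matrix,
   conjugates N to 1 + N modulo p. Finally, integer matrices A and B that are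
   congruent modulo p satisfy tr (A^a) = tr (B^a) modulo p^(k+1) whenever p^k
   divides a. *)
Require Import Defs.
From mathcomp Require Import all_boot.
From mathcomp Require Import all_algebra.
From mathcomp Require Import zify.

Import GRing.Theory.

(** For t > 0, the p-adic valuation of i is less than i, so replacing the factor i by p ^ i gains at
    least one power of p. *)
Lemma dvdn_expS_mul_of_dvdn_mul (p k i t : nat) :
  prime p -> 0 < i -> p ^ k %| i * t -> p ^ k.+1 %| p ^ i * t.
Proof.
move=> p_pr i_gt0 dvd_it.
have [->|t_gt0] := posnP t; first by rewrite muln0 dvdn0.
have pi_gt0 : 0 < p ^ i by rewrite expn_gt0 prime_gt0.
move: dvd_it; rewrite !pfactor_dvdn ?muln_gt0 ?i_gt0 ?pi_gt0 //.
rewrite !lognM // pfactorK // => le_k.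
have := ltn_logl p i_gt0; lia.
Qed.

(** Since j * C(p ^ e, j) = p ^ e * C(p ^ e - 1, j - 1), a binomial prime to p would force p ^ e to
    divide j. *)
Lemma prime_dvd_bin_exp (p e j : nat) :
  prime p -> 0 < j < p ^ e -> p %| 'C(p ^ e, j).
Proof.
move=> p_pr /andP[j_gt0 j_lt].
apply: contraLR j_lt => ndvd; rewrite -leqNgt dvdn_leq //.
have co : coprime (p ^ e) 'C(p ^ e, j) by rewrite coprimeXl // prime_coprime.
rewrite -(Gauss_dvdl j co); case: j j_gt0 {ndvd co} => // j _.
by rewrite -mul_bin_diag dvdn_mulr.
Qed.

Lemma big_ord_multiples (n a : nat) (F : nat -> nat) : 0 < n ->
  \sum_(i < a | n %| i) F i = \sum_(0 <= b < a | b * n < a) F (b * n).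
Proof.
move=> n_gt0; case: a => [|a]; first by rewrite big_ord0 big_geq.
rewrite big_mkord.
rewrite (reindex_onto (fun b : 'I_a.+1 => inord (b * n) : 'I_a.+1)
  (fun i : 'I_a.+1 => inord (i %/ n))) /=; last first.
  move=> i dvd_i; apply: val_inj.
  have lt_id : i %/ n < a.+1 := leq_ltn_trans (leq_div _ _) (ltn_ord i).
  by rewrite /= !inordK ?divnK.
(* When b * n is out of range, [inord] returns a default value, and the round trip fails: it would
   bound b * n by an element of ['I_a.+1]. *)
have in_rangeE (b : 'I_a.+1) :
    (n %| (inord (b * n) : 'I_a.+1)) && (inord ((inord (b * n) : 'I_a.+1) %/ n) == b)
    = (b * n < a.+1).
  case: ltnP => [lt_bn|ge_bn].
    by rewrite inordK // dvdn_mull // mulnK // inord_val eqxx.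
  apply: contraTF ge_bn => /andP[_ /eqP b_eq]; rewrite -ltnNge -b_eq.
  rewrite inordK ?(leq_ltn_trans (leq_div _ _)) //.
  by rewrite (leq_ltn_trans (leq_trunc_div _ _)).
apply: eq_big => [b|b]; rewrite in_rangeE // => lt_bn.
by rewrite inordK.
Qed.

Local Open Scope ring_scope.

Section TracePowers.

Variables (R : comNzRingType) (n : nat).
Implicit Types A B : 'M[{poly R}]_n.+1.

Lemma map_deriv_mulmx A B :
  map_mx deriv (A * B) = map_mx deriv A * B + A * map_mx deriv B.
Proof.
apply/matrixP => i j; rewrite !mxE raddf_sum -big_split.
by apply: eq_bigr => l _; rewrite /= derivM !mxE.
Qed.

Lemma deriv_mxtrace A : (\tr A)^`() = \tr (map_mx deriv A).
Proof. by rewrite raddf_sum; apply: eq_bigr => i _; rewrite !mxE. Qed.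

Lemma deriv_mxtrace_exp A a :
  (\tr (A ^+ a))^`() = \tr (A ^+ a.-1 * map_mx deriv A) *+ a.
Proof.
have comm_tr B m : \tr (B * A ^+ m) = \tr (A ^+ m * B) by apply: mxtrace_mulC.
(* The spare factor [A ^+ m] collects the powers moved around by cyclicity of the trace, as [A] need
   not commute with its derivative. *)
suff H m : \tr (map_mx deriv (A ^+ a) * A ^+ m)
    = \tr (A ^+ (a + m).-1 * map_mx deriv A) *+ a.
  by rewrite deriv_mxtrace -[X in \tr X]mulr1 -(expr0 A) H addn0.
elim: a m => [|a IHa] m.
  rewrite expr0 mulr0n; suff -> : map_mx deriv (1 : 'M[{poly R}]_n.+1) = 0.
    by rewrite mul0r mxtrace0.
  by apply/matrixP => i j; rewrite !mxE -mulr_natr mul1r derivMn derivC mul0rn.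
rewrite exprSr map_deriv_mulmx mulrDl mxtraceD -mulrA -exprS IHa addnS addSn /=.
rewrite mulrSr; congr (_ + _).
by rewrite -mulrA mxtrace_mulC -[(_ *m _)]/(_ * _) -mulrA -exprD comm_tr addnC.
Qed.

End TracePowers.

(* With t(s) = tr ((A + s C)^a), the derivative t' is a multiple of a, so each
   coefficient t_i satisfies a %| i * t_i, which forces p^(k+1) %| p^i * t_i. *)
Lemma dvdz_mxtrace_exp_sub (n p k a : nat) (A C : 'M[int]_n.+1) :
    prime p -> (p ^ k %| a)%N ->
  ((p ^ k.+1)%N %| \tr ((A + C *+ p) ^+ a) - \tr (A ^+ a))%Z.
Proof.
move=> p_pr dvd_a.
pose P : 'M[{poly int}]_n.+1 := map_mx polyC A + 'X *: map_mx polyC C.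
pose t := \tr (P ^+ a).
have horner_t x : t.[x] = \tr ((A + x *: C) ^+ a).
  rewrite -[t.[x]]/(horner_eval x t) -trace_map_mx rmorphXn /=.
  congr (\tr (_ ^+ a)); apply/matrixP => i j.
  by rewrite !mxE /horner_eval !hornerE.
have -> : A ^+ a = (A + 0 *: C) ^+ a by rewrite scale0r addr0.
have -> : A + C *+ p = A + p%:Z *: C by rewrite -scaler_nat natz.
rewrite -!horner_t !horner_coef.
have [->|t_neq0] := eqVneq (size t) 0%N; first by rewrite !big_ord0.
rewrite -sumrB; apply: (big_ind (fun x => (_ %| x)%Z)) => // [|[i /= _] _].
  by move=> x y; apply: rpredD.
case: i => [|i]; first by rewrite !expr0 subrr.
rewrite expr0n mulr0 subr0.
have t_i : t`_i.+1 *+ i.+1 = (\tr (P ^+ a.-1 * map_mx deriv P))`_i *+ a.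
  by rewrite -coef_deriv deriv_mxtrace_exp coefMn.
rewrite dvdzE abszM abszX !absz_nat mulnC.
apply: dvdn_expS_mul_of_dvdn_mul => //.
have absMn (x : int) m : `|x *+ m|%N = (`|x| * m)%N.
  by rewrite -mulr_natr natz abszM absz_nat.
by rewrite mulnC -absMn t_i absMn dvdn_mull.
Qed.

Lemma mxtrace_exp_conj (R : comUnitRingType) (n a : nat) (M A : 'M[R]_n.+1) :
  M \is a GRing.unit -> \tr ((M^-1 * (A * M)) ^+ a) = \tr (A ^+ a).
Proof.
move=> Mu; have -> : (M^-1 * (A * M)) ^+ a = M^-1 * (A ^+ a * M).
  elim: a => [|a IHa]; first by rewrite !expr0 mul1r mulVr.
  by rewrite !exprSr IHa -!mulrA mulVKr.
by rewrite mxtrace_mulC -[(_ *m _)]/(_ * _) -mulrA mulrV // mulr1.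
Qed.

Section MapMatrix.

Variables (n : nat) (f : 'I_n.+1 -> 'I_n.+1).

Definition fun_mx : 'M[int]_n.+1 := \matrix_(i, j) (f i == j)%:R.

Lemma mul_fun_mxE (B : 'M[int]_n.+1) i j : (fun_mx * B) i j = B (f i) j.
Proof.
rewrite mxE (bigD1 (f i)) //= mxE eqxx mul1r big1 ?addr0 // => l ne_l.
by rewrite mxE eq_sym (negPf ne_l) mul0r.
Qed.

Lemma exp_fun_mxE m i j : (fun_mx ^+ m) i j = (iter m f i == j)%:R.
Proof.
elim: m i => [|m IHm] i; first by rewrite mxE.
by rewrite exprS mul_fun_mxE IHm iterSr.
Qed.

End MapMatrix.

Section Shift.

Variables (n : nat) (n_gt0 : (0 < n)%N).

(* The exponent of [Y * Y ^ i] after reduction modulo [Y ^ n.+1 = Y]. *)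
Definition shift (i : 'I_n.+1) : 'I_n.+1 := inord (if (i < n)%N then i.+1 else 1).

Lemma shiftE i : shift i = (if (i < n)%N then i.+1 else 1%N) :> nat.
Proof. by rewrite inordK //; case: ifP. Qed.

Lemma iter_shiftE m (i : 'I_n) :
  iter m shift (lift ord0 i) = ((i + m) %% n).+1 :> nat.
Proof.
elim: m => [|m IHm]; first by rewrite addn0 modn_small.
rewrite iterS shiftE IHm addnS -[(i + m).+1]addn1 -[in RHS]modnDml addn1.
have := ltn_pmod (i + m) n_gt0; rewrite leq_eqVlt => /predU1P[->|lt_n]; last first.
  by rewrite lt_n [in RHS]modn_small.
by rewrite modnn ltnn.
Qed.

(** The trace counts the fixed points of the m-th iterate of [shift], which never takes the value 0
    and is an n-cycle on 1, ..., n. *)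
Lemma mxtrace_exp_shift m : (0 < m)%N ->
  \tr (fun_mx n shift ^+ m) = (n * (n %| m))%N%:R.
Proof.
case: m => // m _; rewrite /mxtrace big_ord_recl exp_fun_mxE iterS.
have -> : (shift (iter m shift ord0) == ord0) = false.
  by apply/eqP => /(congr1 val); rewrite /= shiftE; case: ifP.
rewrite add0r -[n in (n * _)%N]card_ord -sum_nat_const natr_sum.
apply: eq_bigr => i _; rewrite exp_fun_mxE -val_eqE [X in X == _]iter_shiftE /=.
rewrite /bump /= add1n eqSS -{2}[i : nat](@modn_small _ n) //.
by rewrite -{2}[i : nat]addn0 eqn_modDl mod0n.
Qed.

(* Row [i] lists the coefficients of [(1 + Y) ^ i]. *)
Definition pascal : 'M[int]_n.+1 := \matrix_(i, j) 'C(i, j)%:R.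

Lemma det_pascal : \det pascal = 1.
Proof.
rewrite det_trig; first by rewrite big1 // => i _; rewrite mxE binn.
by apply/is_trig_mxP => i j lt_ij; rewrite mxE bin_small.
Qed.

(** Row i represents (1 + Y) ^ (i + 1). Only i = n overflows, and its leading monomial Y ^ (n + 1)
    becomes Y, whence the extra 1 in column 1. *)
Lemma pascal_shiftE (i j : 'I_n.+1) :
  (pascal * (1 + fun_mx n shift)) i j
  = ('C(i.+1, j) + (i == n :> nat) * (j == 1%N :> nat))%N%:R.
Proof.
rewrite mulrDr mulr1 !mxE.
have -> : \sum_l pascal i l * fun_mx n shift l j
   = ((0 < j) * 'C(i, j.-1) + (i == n :> nat) * (j == 1%N :> nat))%N%:R.
  rewrite big_ord_recr /= !mxE -val_eqE /= shiftE ltnn.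
  rewrite natrD natrM; congr (_ + _).
    case: j => [[|j] lt_j] /=.
      rewrite mul0r big1 // => l _; rewrite !mxE -val_eqE /= shiftE /=.
      by rewrite ltn_ord mulr0.
    rewrite (bigD1 (Ordinal (lt_j : j < n)%N)) //= !mxE -val_eqE /= shiftE /=.
    rewrite (lt_j : j < n)%N eqxx mulr1 mul1r big1 ?addr0 // => l ne_l.
    rewrite !mxE -val_eqE /= shiftE /= ltn_ord eqSS.
    by rewrite (negPf (_ : (l : nat) != j)) ?mulr0.
  rewrite [1%N == _]eq_sym natrM; congr (_ * _); congr _%:R.
  have := ltn_ord i; rewrite ltnS leq_eqVlt => /predU1P[->|lt_i].
    by rewrite binn eqxx.
  by rewrite bin_small // ltn_eqF.
rewrite -natrD addnA; congr (_ + _)%N%:R.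
by case: (j : nat) => [|j']; rewrite ?bin0 // binS mul1n.
Qed.

(** Rows i < n agree exactly. With q = n + 1, row n compares the reduced (1 + Y) ^ q with 1 + Y, and
    the difference consists of the C(q, j) with 0 < j < q. *)
Lemma pascal_shift_mod (p e : nat) : prime p -> n.+1 = (p ^ e)%N ->
  exists E, pascal * (1 + fun_mx n shift) = fun_mx n shift * pascal + E *+ p.
Proof.
move=> p_pr q_eq.
pose D := pascal * (1 + fun_mx n shift) - fun_mx n shift * pascal.
exists (map_mx (fun x => (x %/ p)%Z) D).
suff dvdD i j : (p %| D i j)%Z.
  apply/matrixP => i j; rewrite [RHS]mxE mulmxnE [X in X *+ p]mxE.
  by rewrite -mulr_natr natz divzK // addrC !mxE subrK.
rewrite [D i j]mxE [X in _ + X]mxE pascal_shiftE mul_fun_mxE [pascal _ _]mxE.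
rewrite shiftE; have := ltn_ord i; rewrite ltnS leq_eqVlt => /predU1P[->|lt_i].
  rewrite eqxx ltnn mul1n !natz; have lt_j := ltn_ord j.
  case: (j : nat) lt_j => [|[|l]] lt_j /=; first by rewrite !bin0 subrr.
    rewrite bin1 -natz natrD addrK natz q_eq dvdzE.
    by case: e q_eq => [|e]; [case: (n) n_gt0 | rewrite expnS dvdn_mulr].
  rewrite addn0 (@bin_small 1) // subr0 dvdzE q_eq prime_dvd_bin_exp //.
  by rewrite -q_eq lt_j.
by rewrite lt_i (ltn_eqF lt_i) addn0 subrr.
Qed.

Lemma mxtrace_exp_addr_shift a : (0 < a)%N ->
  \tr ((1 + fun_mx n shift) ^+ a)
  = (1 + n * (\sum_(0 <= b < a | (b * n < a)%N) 'C(a, b * n)) + n * (n %| a))%N%:R.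
Proof.
case: a => // a _; rewrite addrC exprD1n raddf_sum.
(* The identity has trace n + 1 rather than n, hence the correction at i = 0. *)
have tr_term (i : 'I_a.+2) : \tr (fun_mx n shift ^+ i *+ 'C(a.+1, i))
    = ('C(a.+1, i) * (n * (n %| i) + (i == 0%N :> nat)))%N%:R.
  rewrite raddfMn /= -[LHS]mulr_natl [RHS]natrM; congr (_ * _).
  case: (posnP i) => [->|i_gt0]; first by rewrite expr0 mxtrace1 dvdn0 muln1 addn1.
  by rewrite mxtrace_exp_shift // addn0.
rewrite (eq_bigr _ (fun i _ => tr_term i)) -natr_sum; congr _%:R.
rewrite big_ord_recr /= binn mul1n addn0; congr addn.
under eq_bigr do rewrite mulnDr.
rewrite big_split /= addnC; congr addn.
  rewrite big_ord_recl /= bin0 mul1n big1 ?addn0 // => i _.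
  by rewrite muln0.
rewrite [LHS](bigID (fun i : 'I_a.+1 => (n %| i)%N)) /=.
rewrite [X in (_ + X)%N]big1 ?addn0 => [|i /negPf->]; last by rewrite !muln0.
rewrite -big_ord_multiples // big_distrr /=; apply: eq_bigr => i ->.
by rewrite muln1 mulnC.
Qed.

End Shift.

Local Close Scope ring_scope.

(* For q > 1 the integers b with 0 <= b (q - 1) < a are exactly the naturals
   b < a with b (q - 1) < a; the subtraction q - 1 is then exact. *)
Theorem theorem1p1 (p q k a : nat)
    (p_prime : prime p)
    (q_power : exists2 e : nat, 0 < e & q = p ^ e)
    (a_gt0 : 0 < a)
    (pk_dvd_a : p ^ k %| a) :
  1 + (q - 1) * (\sum_(0 <= b < a | b * (q - 1) < a) 'C(a, b * (q - 1)))
    = 0 %[mod p ^ (k + 1)].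
Proof.
case: q_power => e e_gt0 q_eq.
have q_gt1 : 1 < q by rewrite q_eq -{1}(expn0 p) ltn_exp2l ?prime_gt1.
case: q q_eq q_gt1 => // n q_eq n_gt0; rewrite subn1 /= addn1.
have [E pascalE] := pascal_shift_mod n n_gt0 p e p_prime q_eq.
have Mu : (pascal n \is a GRing.unit)%R by rewrite unitmxE det_pascal unitr1.
(* The Pascal matrix is invertible over the integers, so the error term remains a multiple of p
   after conjugation. *)
have shiftE : (1 + fun_mx n (shift n) = (pascal n)^-1 * (fun_mx n (shift n) * pascal n)
    + ((pascal n)^-1 * E) *+ p)%R.
  by rewrite -mulrnAr -mulrDr -pascalE mulKr.
have := dvdz_mxtrace_exp_sub n p k a ((pascal n)^-1 * (fun_mx n (shift n) * pascal n))%R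
  ((pascal n)^-1 * E)%R p_prime pk_dvd_a.
rewrite -shiftE mxtrace_exp_conj // mxtrace_exp_shift //.
(* The top binomial term n * (n %| a) is the trace of N ^ a and cancels. *)
rewrite mxtrace_exp_addr_shift // [(_ + n * (n %| a))%N]addnC natrD addrC addKr.
by rewrite natz dvdzE !absz_nat => /eqP; rewrite mod0n.
Qed.
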